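(* For every integer $r\geq 1$, \[\sum_{\lambda\leq N}\rho_{r^2}(\lambda)\sim \frac{6}{\pi^2}\,N\log N \qquad (N\to\infty).\]
   Context: For integers $k\geq 0$ and $d\geq 1$, $\rho_k(d):=\#\{0\leq x<d:\ x^2\equiv k \pmod d\}$. The sum runs over positive integers $\lambda\le N$. *)

(* Defs.v *)
From Stdlib Require Import Reals Arith List.
Import ListNotations.
Open Scope R_scope.

Definition rho (k d : nat) : nat :=
  length (filter (fun x => Nat.eqb ((x * x) mod d) (k mod d)) (seq 0 d)).

Definition rho_sum (k N : nat) : nat :=
  fold_right Nat.add 0%nat (map (rho k) (seq 1 N)).

(* Main.v *)
(* With m = 2r and y = x - r, the sum counts the pairs (d, y), y < d <= N, with
   d | y (y + m).  Let b and b' be the denominators of y/d and (y + m)/d in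
   lowest terms; then b b' <= d, so one of them is at most sqrt N, and
   y -> - y - m exchanges them.  When b is fixed, write d = a b and y = a t with
   t a unit mod b: the condition becomes b | a t + m, i.e. a lies in one residue
   class mod b.  Hence there are N phi(b) / b^2 + O(phi(b)) pairs with a given b.
   The pairs for which both denominators are at most sqrt N are only O(N), because
   then a <= m b'.  So the sum is 2 N F(sqrt N) + O(N), where F is the partial sum
   of phi(b) / b^2.  Summing the identity sum_(b | n) phi(b) = n against 1 / n^2
   relates F to the harmonic sum and gives F(x) ~ ln x / zeta(2), without Moebius
   inversion.  The value of zeta(2) comes from iterating
   4 / sin^2 x = 1 / sin^2 (x / 2) + 1 / cos^2 (x / 2) from x = pi / 4. *)
Require Import Defs.
From Stdlib Require Import Reals Lra.
From HB Require structures.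
From mathcomp Require all_boot zify.
Open Scope R_scope.

(** * Trigonometric and logarithmic inequalities *)

(** The difference of the two sides vanishes at 0 and has derivative x sin x, positive on (0, pi /
    2). *)
Lemma sin_gt_mul_cos x : 0 < x -> x < PI / 2 -> x * cos x < sin x.
Proof.
intros x_gt0 x_lt.
destruct (MVT_cor2 (fun x => sin x - x * cos x) (fun x => x * sin x) 0 x x_gt0)
  as [c [E [c_gt0 c_lt]]].
{ intros c _.
  replace (c * sin c) with (cos c - (1 * cos c + c * - sin c)) by ring.
  apply derivable_pt_lim_minus; [apply derivable_pt_lim_sin|].
  apply (derivable_pt_lim_mult id cos); [apply derivable_pt_lim_id|].
  apply derivable_pt_lim_cos. }
rewrite sin_0 in E.
assert (0 < sin c) by (apply sin_gt_0; lra).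
assert (0 < c * sin c * (x - 0)) by (repeat apply Rmult_lt_0_compat; lra).
lra.
Qed.

(** The lower bound is sin x < x. As 1 / sin^2 x = 1 + cot^2 x, the upper one is cot x < 1 / x,
    which is [sin_gt_mul_cos]. *)
Lemma inv_sqr_sin_bounds x : 0 < x -> x < PI / 2 ->
  / x ^ 2 <= / sin x ^ 2 <= / x ^ 2 + 1.
Proof.
intros x_gt0 x_lt.
assert (s_gt0 : 0 < sin x) by (apply sin_gt_0; lra).
assert (c_gt0 : 0 < cos x) by (apply cos_gt_0; lra).
pose proof (sin_lt_x x x_gt0); pose proof (sin_gt_mul_cos x x_gt0 x_lt).
pose proof (sin2_cos2 x) as E; unfold Rsqr in E.
split; [apply Rinv_le_contravar; nra|].
apply (Rmult_le_reg_r (x ^ 2 * sin x ^ 2)).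
{ apply Rmult_lt_0_compat; apply pow_lt; assumption. }
replace (/ sin x ^ 2 * (x ^ 2 * sin x ^ 2)) with (x ^ 2) by (field; lra).
replace ((/ x ^ 2 + 1) * (x ^ 2 * sin x ^ 2))
  with (sin x ^ 2 + x ^ 2 * sin x ^ 2) by (field; lra).
assert ((x * cos x) * (x * cos x) <= sin x * sin x)
  by (apply Rmult_le_compat; nra).
nra.
Qed.

(** The cosine of x / 2 is written as the sine of the complementary angle, so that both terms on the
    left fit into a single sum of 1 / sin^2 in [sum_inv_sqr_sin]. *)
Lemma inv_sqr_sin_duplication x : 0 < x -> x < PI / 2 ->
  / sin (x / 2) ^ 2 + / sin (PI / 2 - x / 2) ^ 2 = 4 * / sin x ^ 2.
Proof.
intros x_gt0 x_lt.
assert (s_gt0 : 0 < sin (x / 2)) by (apply sin_gt_0; lra).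
assert (c_gt0 : 0 < cos (x / 2)) by (apply cos_gt_0; lra).
pose proof (sin2_cos2 (x / 2)) as E; unfold Rsqr in E.
rewrite sin_shift.
replace (sin x) with (2 * sin (x / 2) * cos (x / 2))
  by (rewrite <- sin_2a; f_equal; field).
apply (Rmult_eq_reg_r (sin (x / 2) ^ 2 * cos (x / 2) ^ 2)).
2: { apply Rgt_not_eq, Rmult_lt_0_compat; apply pow_lt; assumption. }
field_simplify; [|lra|lra].
nra.
Qed.

Lemma ln_le_sub1 x : 0 < x -> ln x <= x - 1.
Proof.
intros x_gt0; pose proof (exp_ineq1_le (ln x)) as H; rewrite exp_ln in H; lra.
Qed.

Lemma ln_div x y : 0 < x -> 0 < y -> ln (x / y) = ln x - ln y.
Proof.
intros x_gt0 y_gt0; unfold Rdiv.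
rewrite ln_mult, ln_Rinv; [reflexivity | | | apply Rinv_0_lt_compat]; assumption.
Qed.

Lemma ln_le x y : 0 < x -> x <= y -> ln x <= ln y.
Proof.
intros x_gt0 [xy | ->]; [left; apply ln_increasing; assumption | right; reflexivity].
Qed.

Module SquareRoots.

Import HB.structures all_boot zify.
Set Implicit Arguments.
Unset Strict Implicit.
Unset Printing Implicit Defensive.
Local Open Scope nat_scope.

(** * Counting square roots of r^2 *)

Lemma sum_shift_periodic d (f : nat -> nat) c :
  (forall y, f (y + d) = f y) ->
  \sum_(0 <= y < d) f (y + c) = \sum_(0 <= y < d) f y.
Proof.
move=> fP; elim: c => [|c IHc]; first by apply: eq_bigr => y _; rewrite addn0.
rewrite -IHc; case: d fP {IHc} => [|d] fP; first by rewrite !big_nil.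
rewrite big_nat_recr //= [RHS]big_nat_recl //= addnC; congr (_ + _).
  by rewrite addnS -addSn addnC fP.
by apply: eq_bigr => y _; rewrite addnS addSn.
Qed.

(** The range [0, A) contains A %/ b full periods and is contained in A %/ b + 1 of them. *)
Lemma sum_periodic_bounds b (f : nat -> nat) A :
    0 < b -> (forall y, f (y + b) = f y) -> \sum_(0 <= y < b) f y = 1 ->
  A %/ b <= \sum_(0 <= a < A) f a <= A %/ b + 1.
Proof.
move=> b_gt0 fP f1.
have mulE q : \sum_(0 <= a < q * b) f a = q.
  elim: q => [|q IHq]; first by rewrite mul0n big_nil.
  rewrite (big_cat_nat (n := q * b)) //= ?leq_mul2r ?leqnSn ?orbT // IHq.
  rewrite -{1}[q * b]add0n big_addn mulSn addnK -addn1; congr (_ + _).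
  rewrite sum_shift_periodic //.
have mono x y : x <= y -> \sum_(0 <= a < x) f a <= \sum_(0 <= a < y) f a.
  by move=> le_xy; rewrite [leqRHS](big_cat_nat (n := x)) //= leq_addr.
rewrite -(mulE (A %/ b + 1)) -{1}(mulE (A %/ b)) !mono ?leq_divM //.
by rewrite addn1 ltnW // ltn_ceil.
Qed.

Lemma sum_multiples (R : Type) (idx : R) (op : Monoid.com_law idx) b N
    (g : nat -> R) : 0 < b ->
  \big[op/idx]_(1 <= d < N.+1 | b %| d) g (d %/ b) =
  \big[op/idx]_(1 <= a < (N %/ b).+1) g a.
Proof.
move=> b_gt0; elim: N => [|N IHN]; first by rewrite div0n !big_geq.
rewrite big_mkcond big_nat_recr //= -big_mkcond IHN [in RHS]divnS //.
case: ifP => bN /=; last by rewrite add0n Monoid.mulm1.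
by rewrite add1n [RHS]big_nat_recr //= divnS // bN.
Qed.

(** Stated for any commutative law because it serves over [nat] in [sum_fractions] and over the
    reals in [harmonicE]. *)
Lemma sum_divisors (R : Type) (idx : R) (op : Monoid.com_law idx) N
    (G : nat -> nat -> R) :
  \big[op/idx]_(1 <= d < N.+1)
     \big[op/idx]_(1 <= b < d.+1 | b %| d) G b (d %/ b) =
  \big[op/idx]_(1 <= b < N.+1) \big[op/idx]_(1 <= a < (N %/ b).+1) G b a.
Proof.
transitivity (\big[op/idx]_(1 <= d < N.+1)
     \big[op/idx]_(1 <= b < N.+1 | b %| d) G b (d %/ b)).
  apply: eq_big_nat => d /andP[d_gt0 dN].
  rewrite [RHS](big_cat_nat (n := d.+1)) //= [X in op _ X]big_nat_cond.
  rewrite [X in op _ X]big_pred0 ?Monoid.mulm1 // => b.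
  by apply/negP => /andP[/andP[db _] /dvdn_leq]; lia.
rewrite (exchange_big_dep_nat predT) //=; apply: eq_big_nat => b /andP[b_gt0 _].
exact: sum_multiples.
Qed.

(* Groups the fractions y / d according to their reduced form t / b. *)
Lemma sum_by_denominator d (f : nat -> nat -> nat) : 0 < d ->
  \sum_(0 <= y < d) f (d %/ gcdn y d) y =
  \sum_(1 <= b < d.+1 | b %| d)
     \sum_(0 <= t < b | coprime t b) f b (d %/ b * t).
Proof.
move=> d_gt0.
(* The denominator b becomes a summation variable that takes exactly one value for each y; the sums
   can then be exchanged. *)
transitivity (\sum_(0 <= y < d) \sum_(1 <= b < d.+1 | d %/ gcdn y d == b) f b y).
  apply: eq_bigr => y _.
  have g_gt0 : 0 < gcdn y d by rewrite gcdn_gt0 d_gt0 orbT.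
  rewrite big_mkcond (bigD1_seq (d %/ gcdn y d)) ?iota_uniq //=; last first.
    rewrite mem_index_iota divn_gt0 // dvdn_leq ?dvdn_gcdr //=.
    by rewrite ltnS leq_div.
  by rewrite eqxx big1 ?addn0 // => b; rewrite eq_sym => /negPf->.
rewrite (exchange_big_dep_nat predT) //= [RHS]big_mkcond.
apply: eq_big_nat => b /andP[b_gt0 _]; case: ifPn => [|bNd]; last first.
  rewrite big1 // => y /eqP bE; case/negP: bNd; rewrite -bE.
  by rewrite dvdn_div ?dvdn_gcdr.
case/dvdnP=> a dE; rewrite dE mulnK // in d_gt0 *.
have a_gt0 : 0 < a by case: (a) d_gt0.
have mulE (g : nat -> nat) n :
    \sum_(0 <= y < a * n | a %| y) g y = \sum_(0 <= t < n) g (a * t).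
  elim: n => [|n IHn]; first by rewrite muln0 !big_nil.
  rewrite (big_cat_nat (n := a * n)) /= ?leq_mul2l ?leqnSn ?orbT // IHn.
  rewrite big_nat_recr //=; congr (_ + _).
  rewrite -{1}[a * n]add0n big_addn mulnS addnK.
  case: (a) a_gt0 => // a' _.
  rewrite big_mkcond big_nat_recl //= add0n dvdn_mulr // big_nat big1 ?addn0 //.
  move=> y ya; case: ifP => //; rewrite dvdn_addl ?dvdn_mulr // => /dvdn_leq.
  lia.
(* With d = a b, the denominator of y / d is b iff gcd(y, d) = a, i.e. iff y = a t with t coprime to
   b. *)
transitivity (\sum_(0 <= y < a * b | a %| y)
                 (if coprime (y %/ a) b then f b y else 0)).
  rewrite big_mkcond [RHS]big_mkcond; apply: eq_bigr => y _.
  case: ifP => [/eqP bE|].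
    have aE : gcdn y (a * b) = a.
      have := divnK (dvdn_gcdr y (a * b)); rewrite bE => /eqP.
      by rewrite mulnC eqn_pmul2r // => /eqP.
    have ay : a %| y by rewrite -aE dvdn_gcdl.
    rewrite ay /coprime -(eqn_pmul2l a_gt0) muln_gcdr mulnC divnK // aE.
    by rewrite muln1 eqxx.
  case: ifP => // /dvdnP[t ->]; rewrite mulnK // [t * a]mulnC -muln_gcdr.
  rewrite divnMl //; case: ifP => // /eqP->.
  by rewrite divn1 eqxx.
rewrite mulE [RHS]big_mkcond; apply: eq_bigr => t _; rewrite mulKn //.
Qed.

(** As t is a unit mod b, the condition confines a to one residue class. *)
Lemma sum_dvdn_linear b t m : 0 < b -> coprime t b ->
  \sum_(0 <= a < b) (b %| a * t + m) = 1.
Proof.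
move=> b_gt0 cotb.
(* [- u] is the inverse of [t] mod [b]. *)
have [u _ bu] := Bezoutl t b_gt0.
rewrite gcdnC (eqP cotb) in bu.
have coub : coprime b u.
  have g1 : gcdn b u %| 1.
    rewrite -(dvdn_addl 1 (dvdn_mulr t (dvdn_gcdr b u))).
    exact: dvdn_trans (dvdn_gcdl b u) bu.
  by rewrite /coprime -dvdn1.
(* Here [b.-1] stands for -1 mod b. Multiplying a t + m by the unit u gives u m - a mod b, so the
   condition becomes divisibility of a translate of a. *)
have dvdE a : (b %| a * t + m) = (b %| a + b.-1 * (u * m)).
  rewrite -(Gauss_dvdr _ coub); set X := u * _; set Y := a + _.
  have XY : X + Y = a * (1 + u * t) + b * (u * m).
    by rewrite /X /Y; case: (b) b_gt0 => // b' _; rewrite -pred_Sn; lia.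
  have bXY : b %| X + Y.
    by rewrite XY; apply: dvdn_add; [exact: dvdn_mull | exact: dvdn_mulr].
  by apply/idP/idP => H; [rewrite -(dvdn_addr _ H) | rewrite -(dvdn_addl _ H)].
under eq_bigr do rewrite dvdE.
rewrite (sum_shift_periodic (f := fun a => b %| a)) => [|y]; last first.
  by rewrite dvdn_addl.
rewrite big_ltn // dvdn0 big_nat big1 // => a /andP[a_gt0 ab].
by case: (b %| a) (@dvdn_leq b a a_gt0) => // /(_ isT); lia.
Qed.

(** For each of the phi(b) units t, the condition on a is b-periodic and holds once per period. The
    range of a starts at 1, whence the shift by one in the proof. *)
Lemma count_pairs_bounds b m A : 0 < b ->
  totient b * (A %/ b) <=
  \sum_(1 <= a < A.+1) \sum_(0 <= t < b | coprime t b) (b %| a * t + m) <=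
  totient b * (A %/ b + 1).
Proof.
move=> b_gt0; rewrite exchange_big_nat /= totient_count_coprime !big_distrl /=.
have le_t t : coprime t b -> A %/ b <= \sum_(1 <= a < A.+1) (b %| a * t + m) <= A %/ b + 1.
  move=> cotb; rewrite big_add1 /=.
  under eq_bigr do rewrite -addn1.
  pose f a := (b %| a * t + m) : nat.
  have fP y : f (y + b) = f y by rewrite /f mulnDl addnAC dvdn_addl // dvdn_mulr.
  apply: (sum_periodic_bounds (f := fun a => f (a + 1))) => // [y|].
    by rewrite addnAC fP.
  by rewrite sum_shift_periodic // sum_dvdn_linear.
rewrite [X in _ <= X <= _]big_mkcond; apply/andP; split; apply: leq_sum => t _;
  rewrite [coprime b t]coprime_sym; case: ifP => [cotb|_]; rewrite ?mul1n ?mul0n //.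
all: by case/andP: (le_t _ cotb).
Qed.

(** Writing d = a b and y = a t with t coprime to b, the condition a b | a t (a t + m) reduces to b
    | a t + m. The filter [Q] will be b <= M for the main count and a bound on both b and a for the
    overlap. *)
Lemma sum_fractions m N (Q : nat -> nat -> bool) :
  \sum_(1 <= d < N.+1) \sum_(0 <= y < d)
     (d %| y * (y + m)) && Q (d %/ gcdn y d) (gcdn y d) =
  \sum_(1 <= b < N.+1) \sum_(1 <= a < (N %/ b).+1 | Q b a)
     \sum_(0 <= t < b | coprime t b) (b %| a * t + m).
Proof.
transitivity (\sum_(1 <= d < N.+1) \sum_(1 <= b < d.+1 | b %| d)
   (if Q b (d %/ b) then
      \sum_(0 <= t < b | coprime t b) (b %| d %/ b * t + m) else 0)); last first.
  rewrite (sum_divisors _ _ (fun b a =>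
    if Q b a then \sum_(0 <= t < b | coprime t b) (b %| a * t + m) else 0)).
  by apply: eq_bigr => b _; rewrite [RHS]big_mkcond.
apply: eq_big_nat => d /andP[d_gt0 _].
transitivity (\sum_(0 <= y < d) ((d %| y * (y + m))
    && Q (d %/ gcdn y d) (d %/ (d %/ gcdn y d)))).
  by apply: eq_bigr => y _; rewrite divnA ?dvdn_gcdr // mulKn.
rewrite (sum_by_denominator (fun b y => (d %| y * (y + m)) && Q b (d %/ b) : nat)) //.
rewrite big_mkcond [RHS]big_mkcond; apply: eq_big_nat => b /andP[b_gt0 _].
case: ifP => // /dvdnP[a dE]; rewrite dE mulnK // in d_gt0 *.
have a_gt0 : 0 < a by case: (a) d_gt0.
case: (Q b a); last by rewrite big1 // => t _; rewrite andbF.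
apply: eq_bigr => t cotb; rewrite andbT -mulnA dvdn_pmul2l //.
by rewrite Gauss_dvdr // coprime_sym.
Qed.

(** The involution y -> - y - m of the residues mod d preserves y (y + m) and exchanges y with y + m
    up to sign. *)
Lemma sum_dvdn_symmetric m d (Q : nat -> bool) : 0 < d ->
  \sum_(0 <= y < d) (d %| y * (y + m)) && Q (gcdn (y + m) d) =
  \sum_(0 <= y < d) (d %| y * (y + m)) && Q (gcdn y d).
Proof.
move=> d_gt0; pose f y := (d %| y * (y + m)) && Q (gcdn y d) : nat.
have fP y : f (y + d) = f y.
  rewrite /f [gcdn (y + d) d]gcdnC gcdnDr [gcdn d y]gcdnC; congr (nat_of_bool (_ && _)).
  have -> : (y + d) * (y + d + m) = y * (y + m) + d * (2 * y + d + m) by lia.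
  by rewrite dvdn_addl // dvdn_mulr.
(* The involution without negative numbers: one side is reversed by y -> d - 1 - y, the other is
   shifted by 1 + (d - 1) m, which is 1 - m mod d. Then z + m = - w mod d. *)
rewrite -[RHS](sum_shift_periodic (1 + d.-1 * m) fP) big_nat_rev /=.
apply: eq_big_nat => y /andP[_ yd]; rewrite /f add0n.
set z := d - y.+1; set w := y + _.
have dzw : z + m + w = d * m.+1.
  have -> : d * m.+1 = d + (d.-1 * m + m).
    by rewrite mulnS -{2}(prednK d_gt0) mulSn [m + _]addnC.
  by rewrite /z /w; lia.
have dvd_iff a b : d %| a + b -> (d %| a) = (d %| b).
  move=> H; apply/idP/idP => H1.
    by rewrite -(dvdn_addr _ H1).
  by rewrite -(dvdn_addl _ H1).
congr (nat_of_bool (_ && Q _)).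
  transitivity (d %| z * w); last rewrite [w * _]mulnC; apply: dvd_iff.
    by rewrite -mulnDr dzw dvdn_mull ?dvdn_mulr.
  have -> : z * w + (w + m) * w = d * m.+1 * w by rewrite -dzw; lia.
  by rewrite -mulnA dvdn_mulr.
apply/eqP; rewrite eqn_dvd !dvdn_gcd !dvdn_gcdr !andbT.
have dvd_gcd a b : a + b = d * m.+1 -> gcdn a d %| b.
  move=> E; rewrite -(dvdn_addr _ (dvdn_gcdl a d)) E.
  exact: dvdn_mulr (dvdn_gcdr a d).
by rewrite !dvd_gcd // addnC.
Qed.

Lemma dvdn_mul_gcd d x y : d %| x * y -> d %| gcdn x d * gcdn y d.
Proof.
move=> dxy; rewrite muln_gcdl !muln_gcdr !dvdn_gcd dxy.
by rewrite (dvdn_mull x (dvdnn d)) !dvdn_mulr.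
Qed.

(** Let a and a' be the two gcds and b' = d / a'. Since d | a a', a = g b' for some g. This g
    divides both a and a', hence y and y + m, hence m, so g <= m. *)
Lemma gcdn_le_codivisor m d y : 0 < d -> 0 < m -> d %| y * (y + m) ->
  gcdn y d <= m * (d %/ gcdn (y + m) d).
Proof.
move=> d_gt0 m_gt0 /dvdn_mul_gcd; set a := gcdn y d; set a' := gcdn _ d.
have a_gt0 : 0 < a by rewrite gcdn_gt0 d_gt0 orbT.
have a'_gt0 : 0 < a' by rewrite gcdn_gt0 d_gt0 orbT.
have dE : d = d %/ a * a by rewrite divnK ?dvdn_gcdr.
have dE' : d = d %/ a' * a' by rewrite divnK ?dvdn_gcdr.
move=> daa'; have b'a : d %/ a' %| a by rewrite -(dvdn_pmul2r a'_gt0) -dE'.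
case/dvdnP: b'a => g aE; rewrite {1}aE leq_mul2r dvdn_leq ?orbT //.
have ga : g %| a by rewrite aE dvdn_mulr.
have ga' : g %| a'.
  suff -> : a' = g * (d %/ a) by rewrite dvdn_mulr.
  apply/eqP; rewrite -(eqn_pmul2r a_gt0) -mulnA -dE [X in g * X]dE'.
  by rewrite mulnA -aE mulnC.
rewrite -(dvdn_addr _ (dvdn_trans ga (dvdn_gcdl y d))).
exact: dvdn_trans ga' (dvdn_gcdl _ _).
Qed.

(** Substituting x = y + r gives x^2 - r^2 = y (y + 2 r); by periodicity the shifted range still
    runs over all residues. *)
Lemma rhoE r d : 0 < d ->
  rho (r * r) d = \sum_(0 <= y < d) (d %| y * (y + 2 * r)).
Proof.
move=> d_gt0.
have modE a : Nat.modulo a d = a %% d.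
  apply/esym/(PeanoNat.Nat.mod_unique _ _ (a %/ d)).
    exact/ltP/ltn_pmod.
  by rewrite {1}(divn_eq a d) mulnC.
pose f x := (x * x == r * r %[mod d]) : nat.
transitivity (\sum_(0 <= x < d) f x).
  rewrite /rho unlock /index_iota subn0 -[List.seq 0 d]/(iota 0 d).
  elim: (iota 0 d) => //= x s <-; rewrite /f !modE.
  case: PeanoNat.Nat.eqb_spec => [->|/eqP/negPf]; first by rewrite eqxx.
  by move=> /= ->.
rewrite -(sum_shift_periodic (f := f) r) => [|y].
  apply: eq_bigr => y _; rewrite /f eqn_mod_dvd ?leq_mul ?leq_addl //.
  by congr (nat_of_bool (d %| _)); lia.
rewrite /f; have -> : (y + d) * (y + d) = (y + y + d) * d + y * y by lia.
by rewrite modnMDl.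
Qed.

Lemma sum_nat_le K L (F : nat -> nat) : K <= L ->
  \sum_(1 <= a < L.+1 | a <= K) F a = \sum_(1 <= a < K.+1) F a.
Proof. by move=> KL; rewrite [RHS](big_nat_widen _ _ L.+1). Qed.

Lemma sum_nat_le_leq K L (F : nat -> nat) :
  \sum_(1 <= a < L.+1 | a <= K) F a <= \sum_(1 <= a < K.+1) F a.
Proof.
rewrite -(sum_nat_le F (leq_addl L K)) [leqRHS](big_cat_nat (n := L.+1)) //=.
  exact: leq_addr.
by rewrite ltnS leq_addr.
Qed.

Lemma totient_le b : totient b <= b.
Proof.
rewrite totient_count_coprime -[leqRHS]muln1 -[X in X * 1]subn0.
by rewrite -sum_nat_const_nat leq_sum // => t _; case: coprime.
Qed.

(** The hypotheses make M the integer square root of N. The term (2 r + 1) M^2 pays for the pairs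
    with both denominators at most M, which are counted twice. *)
Lemma rho_sum_bounds r N M : 0 < r -> M * M <= N -> N < M.+1 * M.+1 ->
  rho_sum (r * r) N <= 2 * \sum_(1 <= b < M.+1) totient b * (N %/ (b * b) + 1) /\
  2 * \sum_(1 <= b < M.+1) totient b * (N %/ (b * b)) <=
    rho_sum (r * r) N + (2 * r + 1) * (M * M).
Proof.
move=> r_gt0 MN NM; set m := 2 * r.
have m_gt0 : 0 < m by rewrite muln_gt0.
pose T b A := \sum_(1 <= a < A.+1) \sum_(0 <= t < b | coprime t b) (b %| a * t + m).
have sumM (F : nat -> nat) :
    \sum_(1 <= b < N.+1) (if b <= M then F b else 0) = \sum_(1 <= b < M.+1) F b.
  by rewrite -big_mkcond sum_nat_le //; nia.
set S := rho_sum _ _.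
have SE : S = \sum_(1 <= d < N.+1) \sum_(0 <= y < d) (d %| y * (y + m)).
  rewrite /S /rho_sum -[List.seq 1 N]/(iota 1 N).
  transitivity (\sum_(1 <= d < N.+1) rho (r * r) d).
    by rewrite unlock /index_iota subn1; elim: (iota 1 _) => //= x s <-.
  by apply: eq_big_nat => d /andP[d_gt0 _]; rewrite rhoE.
(* Inclusion-exclusion on which of the two denominators is at most [M]. *)
pose U := \sum_(1 <= d < N.+1) \sum_(0 <= y < d)
  (d %| y * (y + m)) && (d %/ gcdn y d <= M).
pose U' := \sum_(1 <= d < N.+1) \sum_(0 <= y < d)
  (d %| y * (y + m)) && (d %/ gcdn (y + m) d <= M).
pose V := \sum_(1 <= d < N.+1) \sum_(0 <= y < d)
  (d %| y * (y + m)) && ((d %/ gcdn y d <= M) && (d %/ gcdn (y + m) d <= M)).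
have SV : S + V = U + U'.
  rewrite SE -!big_split; apply: eq_big_nat => d /andP[d_gt0 dN] /=.
  rewrite -!big_split; apply: eq_bigr => y _ /=.
  case: (boolP (d %| _)) => //= /dvdn_mul_gcd/dvdn_leq.
  have := divnK (dvdn_gcdr y d); have := divnK (dvdn_gcdr (y + m) d).
  have : 0 < gcdn y d by rewrite gcdn_gt0 d_gt0 orbT.
  have : 0 < gcdn (y + m) d by rewrite gcdn_gt0 d_gt0 orbT.
  move: (gcdn y d) (gcdn (y + m) d) => a a'.
  move: (d %/ a) (d %/ a') => b b' a'_gt0 a_gt0 dE' dE le_d.
  have {}le_d : d <= a * a' by apply: le_d; rewrite muln_gt0 a_gt0.
  (* From a b = a' b' = d <= a a' follows b b' <= d <= N < (M + 1)^2, so b and b' cannot both exceed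
     M. *)
  case: (leqP b M) => bM; case: (leqP b' M) => //= b'M.
  have bd : b * b' * (a * a') <= d * (a * a').
    by rewrite mulnACA dE dE' leq_mul2l le_d orbT.
  by rewrite leq_pmul2r ?muln_gt0 ?a_gt0 // in bd; nia.
have UU' : U' = U.
  apply: eq_big_nat => d /andP[d_gt0 _].
  by rewrite (sum_dvdn_symmetric m (fun g => d %/ g <= M)).
have UE : U = \sum_(1 <= b < M.+1) T b (N %/ b).
  rewrite /U (sum_fractions m N (fun b _ => b <= M)) -sumM.
  by apply: eq_bigr => b _; case: leqP => // _; rewrite big_pred0_eq.
have boundT b A : 0 < b -> totient b * (A %/ b) <= T b A <= totient b * (A %/ b + 1).
  exact: count_pairs_bounds.
(* When b' <= M, [gcdn_le_codivisor] gives a <= m M. Each b <= M then has at most phi(b) (m M / b +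
   1) <= m M + M pairs. *)
have leV : V <= m.+1 * (M * M).
  apply: (@leq_trans (\sum_(1 <= d < N.+1) \sum_(0 <= y < d)
     (d %| y * (y + m)) && ((d %/ gcdn y d <= M) && (gcdn y d <= m * M)))).
    rewrite /V big_nat [leqRHS]big_nat; apply: leq_sum => d /andP[d_gt0 _].
    apply: leq_sum => y _; case: (boolP (d %| _)) => // dy; rewrite !andTb.
    have le_a : d %/ gcdn (y + m) d <= M -> gcdn y d <= m * M.
      move=> b'M; apply: leq_trans (gcdn_le_codivisor d_gt0 m_gt0 dy) _.
      by rewrite leq_mul2l b'M orbT.
    case: (d %/ gcdn (y + m) d <= M) le_a => [/(_ isT)->|_]; first by [].
    by rewrite andbF.
  rewrite (sum_fractions m N (fun b a => (b <= M) && (a <= m * M))).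
  apply: (@leq_trans (\sum_(1 <= b < M.+1) T b (m * M))).
    rewrite -sumM; apply: leq_sum => b _; case: (leqP b M) => bM /=; last first.
      by rewrite big_pred0_eq.
    exact: sum_nat_le_leq.
  apply: (@leq_trans (\sum_(1 <= b < M.+1) m.+1 * M)); last first.
    by rewrite sum_nat_const_nat subn1 /= mulnCA.
  rewrite big_nat [leqRHS]big_nat; apply: leq_sum => b /andP[b_gt0 bM].
  case/andP: (boundT b (m * M) b_gt0) => _ /leq_trans; apply.
  apply: (leq_trans (leq_mul (totient_le b) (leqnn _))).
  by rewrite mulnDr muln1 mulSn addnC mulnC leq_add // leq_divM.
split.
  have : S <= 2 * U by lia.
  move/leq_trans; apply; rewrite leq_mul2l UE [X in X <= _]big_nat [leqRHS]big_nat leq_sum ?orbT //.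
  by move=> b /andP[b_gt0 _]; case/andP: (boundT b (N %/ b) b_gt0); rewrite divnMA.
apply: (@leq_trans (2 * U)); last by lia.
rewrite leq_mul2l UE [X in X <= _]big_nat [leqRHS]big_nat leq_sum ?orbT //.
by move=> b /andP[b_gt0 _]; case/andP: (boundT b (N %/ b) b_gt0); rewrite divnMA.
Qed.

(** * Finite sums of reals and zeta(2) *)

Local Open Scope R_scope.

HB.instance Definition _ := Monoid.isComLaw.Build R 0 Rplus
  (fun x y z => esym (Rplus_assoc x y z)) Rplus_comm Rplus_0_l.

Local Notation "\rsum_ ( m <= i < n ) F" :=
  (\big[Rplus/0]_(m <= i < n) F)
  (at level 41, F at level 41, i, m, n at level 50).

Lemma rsum_le m n (F G : nat -> R) :
    (forall i, (m <= i < n)%N -> F i <= G i) ->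
  \rsum_(m <= i < n) F i <= \rsum_(m <= i < n) G i.
Proof.
move=> leFG; rewrite big_nat [X in _ <= X]big_nat.
apply: (big_ind2 (fun x y => x <= y)) => //; first exact: Rle_refl.
by move=> *; apply: Rplus_le_compat.
Qed.

Lemma rsum_distrr m n c (F : nat -> R) :
  c * (\rsum_(m <= i < n) F i) = \rsum_(m <= i < n) (c * F i).
Proof.
exact: (big_morph (Rmult c) (Rmult_plus_distr_l c) (Rmult_0_r c)).
Qed.

Lemma rsum_ge0 m n (F : nat -> R) :
  (forall i, (m <= i < n)%N -> 0 <= F i) -> 0 <= \rsum_(m <= i < n) F i.
Proof.
move=> F_ge0; rewrite big_nat; apply: (big_ind (fun x => 0 <= x)) => //.
  exact: Rle_refl.
exact: Rplus_le_le_0_compat.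
Qed.

Lemma INR_add m n : INR (m + n)%N = INR m + INR n.
Proof. exact: plus_INR. Qed.

Lemma INR_mul m n : INR (m * n)%N = INR m * INR n.
Proof. exact: mult_INR. Qed.

Lemma INR_sum m n (F : nat -> nat) :
  INR (\sum_(m <= i < n) F i) = \rsum_(m <= i < n) INR (F i).
Proof. exact: (big_morph INR INR_add (erefl (INR 0))). Qed.

Lemma rsum_add m n (F G : nat -> R) :
  \rsum_(m <= i < n) F i + \rsum_(m <= i < n) G i =
  \rsum_(m <= i < n) (F i + G i).
Proof. by rewrite big_split. Qed.

Lemma rsum_cat m n p (F : nat -> R) : (m <= n)%N -> (n <= p)%N ->
  \rsum_(m <= i < p) F i =
  \rsum_(m <= i < n) F i + \rsum_(n <= i < p) F i.
Proof. exact: big_cat_nat. Qed.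

Lemma rsum_const0 n c : \rsum_(0 <= i < n) c = INR n * c.
Proof.
elim: n => [|n IHn]; first by rewrite big_nil Rmult_0_l.
by rewrite S_INR big_nat_recr //= IHn; ring.
Qed.

Lemma rsum_fold n (F : nat -> R) :
  \rsum_(0 <= k < 2 * n) F k = \rsum_(0 <= k < n) (F k + F (n + (n - k.+1))%N).
Proof.
rewrite big_split /= (big_cat_nat (n := n)) //=; last by rewrite leq_pmull.
congr (_ + _); rewrite -{1}[n]add0n big_addn mulSn mul1n addnK big_nat_rev /=.
by apply: eq_bigr => k _; rewrite add0n addnC.
Qed.

Definition theta (n k : nat) := (2 * INR k + 1) * PI / (4 * INR n).

Lemma theta_bounds n k : (k < n)%N -> 0 < theta n k < PI / 2.
Proof.
move=> kn; have := PI_RGT_0; have k0 := pos_INR k.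
have n_gt0 : 0 < INR n by apply: lt_0_INR; apply/ltP; lia.
have : INR k + 1 <= INR n by rewrite -S_INR; apply/le_INR/leP.
rewrite /theta => kn' pi0; split.
  by apply: Rdiv_lt_0_compat; [apply: Rmult_lt_0_compat; lra | lra].
apply: (Rmult_lt_reg_r (4 * INR n)); first lra.
field_simplify; last lra.
nra.
Qed.

(** Doubling the number of angles replaces each x by x / 2 and pi / 2 - x / 2, the terms that
    [rsum_fold] pairs, and so multiplies the sum by 4. The start is 1 / sin^2 (pi / 4) = 2. *)
Lemma sum_inv_sqr_sin n :
  \rsum_(0 <= k < 2 ^ n) / sin (theta (2 ^ n) k) ^ 2 = 2 * INR (2 ^ n) ^ 2.
Proof.
elim: n => [|n IHn].
  rewrite big_nat1 /theta /= (_ : _ / _ = PI / 4); last by field.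
  rewrite sin_PI4; have := sqrt_sqrt 2; have : 0 < sqrt 2 by apply: sqrt_lt_R0; lra.
  move=> s0 s2.
  have -> : 1 / sqrt 2 * (1 / sqrt 2 * 1) = / (sqrt 2 * sqrt 2) by field; lra.
  by rewrite s2; [field | lra].
have n_gt0 : 0 < INR (2 ^ n) by apply: lt_0_INR; apply/ltP; rewrite expn_gt0.
rewrite expnS rsum_fold INR_mul.
transitivity (4 * (2 * INR (2 ^ n) ^ 2)); last by rewrite [INR 2]/=; ring.
rewrite -IHn rsum_distrr.
apply: eq_big_nat => k /andP[_ kn].
have [th0 th1] := theta_bounds kn.
rewrite -inv_sqr_sin_duplication //; congr (/ sin _ ^ 2 + / sin _ ^ 2).
  by rewrite /theta INR_mul /=; field; lra.
rewrite /theta !INR_mul INR_add minus_INR; last exact/leP.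
by rewrite S_INR /=; field; lra.
Qed.

(** Replacing 1 / sin^2 by 1 / theta^2 in [sum_inv_sqr_sin] costs at most 1 for each of the p = 2^n
    angles. Dividing by 16 p^2 / pi^2 turns the total 2 p^2 into pi^2 / 8 and the loss p into pi^2 /
    (16 p). *)
Lemma odd_sqr_sum_bounds n :
  PI ^ 2 / 8 - PI ^ 2 / (16 * INR (2 ^ n)) <=
  \rsum_(0 <= k < 2 ^ n) / (2 * INR k + 1) ^ 2 <= PI ^ 2 / 8.
Proof.
set p := (2 ^ n)%N; set O := \rsum_(0 <= k < p) _.
have p_gt0 : 0 < INR p by apply: lt_0_INR; apply/ltP; rewrite expn_gt0.
have pi0 := PI_RGT_0.
have E : \rsum_(0 <= k < p) / theta p k ^ 2 = 16 * INR p ^ 2 / PI ^ 2 * O.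
  rewrite /O rsum_distrr; apply: eq_bigr => k _; rewrite /theta.
  by field; have := pos_INR k; lra.
have lo : 16 * INR p ^ 2 / PI ^ 2 * O <= 2 * INR p ^ 2.
  rewrite -E -sum_inv_sqr_sin; apply: rsum_le => k /andP[_ kp].
  by have [th0 th1] := theta_bounds kp; case: (inv_sqr_sin_bounds _ th0 th1).
have hi : 2 * INR p ^ 2 <= 16 * INR p ^ 2 / PI ^ 2 * O + INR p * 1.
  rewrite -E -rsum_const0 -big_split -sum_inv_sqr_sin; apply: rsum_le => k /andP[_ kp].
  by have [th0 th1] := theta_bounds kp; case: (inv_sqr_sin_bounds _ th0 th1).
have c_gt0 : 0 < PI ^ 2 / (16 * INR p ^ 2).
  by apply: Rdiv_lt_0_compat; [apply: pow_lt | have := pow_lt _ 2 p_gt0; lra].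
move/(Rmult_le_compat_l _ _ _ (Rlt_le _ _ c_gt0)): lo.
move/(Rmult_le_compat_l _ _ _ (Rlt_le _ _ c_gt0)): hi.
rewrite Rmult_plus_distr_l.
have -> : PI ^ 2 / (16 * INR p ^ 2) * (16 * INR p ^ 2 / PI ^ 2 * O) = O.
  by field; lra.
have -> : PI ^ 2 / (16 * INR p ^ 2) * (2 * INR p ^ 2) = PI ^ 2 / 8 by field; lra.
have -> : PI ^ 2 / (16 * INR p ^ 2) * (INR p * 1) = PI ^ 2 / (16 * INR p).
  by field; lra.
lra.
Qed.

Definition zeta2 (K : nat) := \rsum_(1 <= e < K.+1) / INR e ^ 2.

Lemma rsum_parity K (F : nat -> R) :
  \rsum_(1 <= e < (2 * K).+1) F e =
  \rsum_(0 <= k < K) F (2 * k).+1 + \rsum_(1 <= e < K.+1) F (2 * e)%N.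
Proof.
elim: K => [|K IHK]; first by rewrite muln0 !big_geq // Rplus_0_l.
rewrite mulnS add2n (big_nat_recr (2 * K).+2) // (big_nat_recr (2 * K).+1) // IHK.
rewrite (big_nat_recr K 0) // (big_nat_recr K.+1) // mulnS add2n.
by rewrite /=; ring.
Qed.

Lemma zeta2_double K :
  zeta2 (2 * K) = \rsum_(0 <= k < K) / (2 * INR k + 1) ^ 2 + zeta2 K / 4.
Proof.
rewrite /zeta2 rsum_parity [_ / 4]Rmult_comm rsum_distrr; congr (_ + _).
  by apply: eq_bigr => k _; rewrite S_INR INR_mul.
apply: eq_big_nat => e /andP[e_gt0 _]; rewrite INR_mul /=; field.
by apply/not_0_INR; lia.
Qed.

(** The limit pi^2 / 6 is the fixed point of z -> pi^2 / 8 + z / 4. The error pi^2 / (4 p)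
    reproduces itself: a quarter of it plus pi^2 / (16 p) is pi^2 / (4 (2 p)). *)
Lemma zeta2_pow2_bounds n :
  PI ^ 2 / 6 - PI ^ 2 / 4 / INR (2 ^ n) <= zeta2 (2 ^ n) <= PI ^ 2 / 6.
Proof.
elim: n => [|n IHn].
  have := PI2_3_2; rewrite /zeta2 big_nat1 /= => pi3.
  by split; [apply: (Rle_trans _ 0); nra | nra].
have n_gt0 : 0 < INR (2 ^ n) by apply: lt_0_INR; apply/ltP; rewrite expn_gt0.
have := odd_sqr_sum_bounds n.
rewrite expnS zeta2_double INR_mul; set O := \rsum_(0 <= k < _) _.
have -> : PI ^ 2 / (16 * INR (2 ^ n)) = PI ^ 2 / INR (2 ^ n) / 16 by field; lra.
have -> : PI ^ 2 / 4 / (INR 2 * INR (2 ^ n)) = PI ^ 2 / INR (2 ^ n) / 8.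
  by rewrite /=; field; lra.
have e : PI ^ 2 / 4 / INR (2 ^ n) = PI ^ 2 / INR (2 ^ n) / 4 by field; lra.
rewrite e in IHn.
have : 0 <= PI ^ 2 / INR (2 ^ n).
  by apply/Rlt_le/Rdiv_lt_0_compat => //; apply: pow_lt; exact: PI_RGT_0.
lra.
Qed.

Lemma inv_sqr_INR_ge0 n : 0 <= / INR n ^ 2.
Proof.
case: n => [|n]; first by rewrite /= Rmult_0_l Rinv_0; exact: Rle_refl.
by apply/Rlt_le/Rinv_0_lt_compat; apply: pow_lt; apply: lt_0_INR; lia.
Qed.

Lemma zeta2_mono K L : (K <= L)%N -> zeta2 K <= zeta2 L.
Proof.
move=> KL; rewrite /zeta2 (@rsum_cat 1 K.+1 L.+1) //.
rewrite -{1}[\rsum_(1 <= e < K.+1) _]Rplus_0_r; apply: Rplus_le_compat_l.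
by apply: rsum_ge0 => e _; exact: inv_sqr_INR_ge0.
Qed.

Lemma zeta2_ub K : zeta2 K <= PI ^ 2 / 6.
Proof.
apply: Rle_trans (zeta2_mono (ltnW (ltn_expl K (isT : 1 < 2)%N))) _.
by case: (zeta2_pow2_bounds K).
Qed.

Lemma zeta2_lb eps : 0 < eps -> exists2 K, (0 < K)%N & PI ^ 2 / 6 - eps < zeta2 K.
Proof.
move=> eps_gt0; have [n nE] := INR_unbounded (PI ^ 2 / 4 / eps).
exists (2 ^ n)%N; first by rewrite expn_gt0.
case: (zeta2_pow2_bounds n) => lo _; apply: Rlt_le_trans lo.
have lt_n : INR n < INR (2 ^ n) by apply/lt_INR/ltP/ltn_expl.
have n_gt0 : 0 < INR (2 ^ n) by have := pos_INR n; lra.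
apply/Rplus_lt_compat_l/Ropp_lt_contravar.
apply: (Rmult_lt_reg_r (INR (2 ^ n) / eps)); first exact: Rdiv_lt_0_compat.
have -> : PI ^ 2 / 4 / INR (2 ^ n) * (INR (2 ^ n) / eps) = PI ^ 2 / 4 / eps.
  by field; lra.
have -> : eps * (INR (2 ^ n) / eps) = INR (2 ^ n) by field; lra.
lra.
Qed.

(** * The sum of phi(b) / b^2 *)

Definition harmonic (n : nat) := \rsum_(1 <= k < n.+1) / INR k.

(** Both sides are ln t <= t - 1, at t = x / (x + 1) and at t = (x + 1) / x. *)
Lemma ln_succ_sub (x : R) : 0 < x -> / (x + 1) <= ln (x + 1) - ln x <= / x.
Proof.
move=> x_gt0; split.
  have : ln (x / (x + 1)) <= x / (x + 1) - 1.
    by apply: ln_le_sub1; apply: Rdiv_lt_0_compat; lra.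
  rewrite ln_div //; last lra.
  have -> : x / (x + 1) - 1 = - / (x + 1) by field; lra.
  lra.
have : ln ((x + 1) / x) <= (x + 1) / x - 1.
  by apply: ln_le_sub1; apply: Rdiv_lt_0_compat; lra.
rewrite ln_div //; last lra.
have -> : (x + 1) / x - 1 = / x by field; lra.
lra.
Qed.

Lemma harmonic_lb n : ln (INR n + 1) <= harmonic n.
Proof.
rewrite /harmonic; elim: n => [|n IHn].
  by rewrite big_nil /= Rplus_0_l ln_1; exact: Rle_refl.
rewrite big_nat_recr //= -/(INR n.+1) S_INR.
have x_gt0 : 0 < INR n + 1 by have := pos_INR n; lra.
have := ln_succ_sub x_gt0; lra.
Qed.

Lemma harmonic_ub n : (0 < n)%N -> harmonic n <= 1 + ln (INR n).
Proof.
rewrite /harmonic; case: n => // n _; elim: n => [|n IHn].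
  by rewrite big_nat1 /= ln_1; lra.
rewrite big_nat_recr // [INR n.+2]S_INR.
have x_gt0 : 0 < INR n.+1 by rewrite S_INR; have := pos_INR n; lra.
have := ln_succ_sub x_gt0; move: IHn; rewrite /=; lra.
Qed.

(** The d fractions y / d are counted by their reduced denominators. *)
Lemma sum_totient_dvdn d : (0 < d)%N ->
  (\sum_(1 <= b < d.+1 | b %| d) totient b)%N = d.
Proof.
move=> d_gt0; transitivity (\sum_(0 <= y < d) 1)%N; last first.
  by rewrite sum_nat_const_nat subn0 muln1.
rewrite (sum_by_denominator (fun _ _ => 1%N)) //; apply: eq_bigr => b _.
rewrite totient_count_coprime [RHS]big_mkcond; apply: eq_bigr => t _.
by rewrite coprime_sym; case: coprime.
Qed.

Definition totient_sum (M : nat) := \rsum_(1 <= b < M.+1) (INR (totient b) / INR b ^ 2).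

(** Each 1 / d is the sum of phi(b) / d^2 over b | d; with d = a b the term splits as phi(b) / b^2
    times 1 / a^2. *)
Lemma harmonicE M :
  harmonic M =
  \rsum_(1 <= b < M.+1) (INR (totient b) / INR b ^ 2 * zeta2 (M %/ b)).
Proof.
transitivity (\rsum_(1 <= b < M.+1) \rsum_(1 <= a < (M %/ b).+1)
    (INR (totient b) / INR b ^ 2 * / INR a ^ 2)); last first.
  by apply: eq_bigr => b _; rewrite rsum_distrr.
rewrite -(sum_divisors _ _ (fun b a => INR (totient b) / INR b ^ 2 * / INR a ^ 2)).
apply: eq_big_nat => d /andP[d_gt0 _].
have d0 : INR d <> 0 by apply: not_0_INR; lia.
transitivity (/ INR d ^ 2 * INR (\sum_(1 <= b < d.+1 | b %| d) totient b)).
  by rewrite sum_totient_dvdn //; field.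
rewrite (big_morph INR INR_add (erefl (INR 0))).
rewrite (big_morph (Rmult _) (Rmult_plus_distr_l _) (Rmult_0_r _)).
rewrite big_nat_cond [RHS]big_nat_cond.
apply: eq_bigr => b /andP[/andP[b_gt0 _] bd].
have b0 : INR b <> 0 by apply: not_0_INR; lia.
have dE : INR d = INR (d %/ b) * INR b by rewrite -INR_mul -[in LHS](divnK bd).
have q0 : INR (d %/ b) <> 0 by move=> q0; rewrite dE q0 Rmult_0_l in d0.
by rewrite dE; field.
Qed.

Lemma totient_term_ge0 b : 0 <= INR (totient b) / INR b ^ 2.
Proof. exact: Rmult_le_pos (pos_INR _) (inv_sqr_INR_ge0 b). Qed.

Lemma totient_sum_lb M : ln (INR M + 1) <= PI ^ 2 / 6 * totient_sum M.
Proof.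
apply: Rle_trans (harmonic_lb M) _; rewrite harmonicE rsum_distrr.
apply: rsum_le => b _; rewrite Rmult_comm; apply: Rmult_le_compat_r.
  exact: totient_term_ge0.
exact: zeta2_ub.
Qed.

Lemma totient_sum_sub K M : (K <= M)%N ->
  totient_sum M - totient_sum K <= harmonic M - harmonic K.
Proof.
move=> KM; rewrite /totient_sum /harmonic !(@rsum_cat 1 K.+1 M.+1) //.
have : \rsum_(K.+1 <= b < M.+1) (INR (totient b) / INR b ^ 2) <=
       \rsum_(K.+1 <= k < M.+1) / INR k.
  apply: rsum_le => b /andP[Kb _].
  have b_gt0 : 0 < INR b by apply: lt_0_INR; lia.
  have -> : / INR b = INR b / INR b ^ 2 by field; lra.
  apply: Rmult_le_compat_r; first exact: inv_sqr_INR_ge0.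
  exact/le_INR/leP/totient_le.
lra.
Qed.

(** For b <= M / K the factor [zeta2 (M %/ b)] in [harmonicE] is at least [zeta2 K], which bounds
    the sum up to M / K. The remaining terms are at most 1 / b and add up to at most 1 + ln K. The
    parameter K stays fixed while M grows. *)
Lemma totient_sum_ub K M : (0 < K)%N -> (0 < M)%N ->
  totient_sum M <= (1 + ln (INR M)) / zeta2 K + 1 + ln (INR K).
Proof.
move=> K_gt0 M_gt0.
have K0 : 0 < INR K by apply: lt_0_INR; lia.
have M0 : 0 < INR M by apply: lt_0_INR; lia.
have z_gt0 : 0 < zeta2 K.
  apply: Rlt_le_trans (zeta2_mono K_gt0).
  by rewrite /zeta2 big_nat1 /=; lra.
have H1 : zeta2 K * totient_sum (M %/ K) <= harmonic M.
  rewrite harmonicE (@rsum_cat 1 (M %/ K).+1) //; last by rewrite ltnS leq_div.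
  rewrite -[X in X <= _]Rplus_0_r rsum_distrr; apply: Rplus_le_compat.
    apply: rsum_le => b /andP[b_gt0]; rewrite ltnS leq_divRL // => bKM.
    rewrite Rmult_comm; apply: Rmult_le_compat_l; first exact: totient_term_ge0.
    by apply: zeta2_mono; rewrite leq_divRL // mulnC.
  apply: rsum_ge0 => b _; apply: Rmult_le_pos; first exact: totient_term_ge0.
  by apply: rsum_ge0 => e _; exact: inv_sqr_INR_ge0.
have H2 := totient_sum_sub (leq_div M K).
have H3 := harmonic_ub M_gt0.
have H4 := harmonic_lb (M %/ K).
have H5 : ln (INR M) - ln (INR K) <= ln (INR (M %/ K) + 1).
  rewrite -ln_div //; apply: ln_le; first exact: Rdiv_lt_0_compat.
  apply: (Rmult_le_reg_r (INR K)) => //.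
  have -> : INR M / INR K * INR K = INR M by field; lra.
  by rewrite -S_INR -INR_mul; apply/le_INR/leP/ltnW/ltn_ceil.
have H6 : totient_sum (M %/ K) <= (1 + ln (INR M)) / zeta2 K.
  apply: (Rmult_le_reg_r (zeta2 K)) => //.
  have -> : (1 + ln (INR M)) / zeta2 K * zeta2 K = 1 + ln (INR M) by field; lra.
  lra.
lra.
Qed.

(** * The asymptotic formula *)

Lemma INR_divn_bounds n d : (0 < d)%N ->
  INR n / INR d - 1 <= INR (n %/ d) <= INR n / INR d.
Proof.
move=> d_gt0; have d0 : 0 < INR d by apply: lt_0_INR; lia.
have nE : INR n / INR d * INR d = INR n by field; lra.
have lo : INR (n %/ d) * INR d <= INR n.
  by rewrite -INR_mul; apply/le_INR/leP/leq_divM.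
have hi : INR n <= (INR (n %/ d) + 1) * INR d.
  by rewrite -S_INR -INR_mul; apply/le_INR/leP/ltnW/ltn_ceil.
split; apply: (Rmult_le_reg_r (INR d)); lra.
Qed.

(** Removing the integer parts costs at most the sum of phi(b) over b <= M, which is at most M^2 <=
    N. In the lower bound, 2 r + 3 is 2 for this loss plus 2 r + 1 for the overlap. *)
Lemma rho_sum_totient_sum r N M : (0 < r)%N -> (0 < N)%N ->
    (M * M <= N)%N -> (N < M.+1 * M.+1)%N ->
  2 * INR N * totient_sum M - (2 * INR r + 3) * INR N <=
    INR (rho_sum (r * r) N) <= 2 * INR N * totient_sum M + 2 * INR N.
Proof.
move=> r_gt0 N_gt0 MN NM; have [] := rho_sum_bounds r_gt0 MN NM.
move=> /leP/le_INR up /leP/le_INR lo.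
rewrite INR_mul INR_sum in up.
rewrite INR_add !INR_mul INR_add INR_mul INR_sum in lo.
have MMN : INR M * INR M <= INR N by rewrite -INR_mul; apply/le_INR/leP.
have Phi : \rsum_(1 <= b < M.+1) INR (totient b) <= INR M * INR M.
  rewrite -INR_sum -INR_mul; apply/le_INR/leP.
  apply: (@leq_trans (\sum_(1 <= b < M.+1) M)).
    rewrite big_nat [leqRHS]big_nat; apply: leq_sum => b /andP[_ bM].
    exact: leq_trans (totient_le b) _.
  by rewrite sum_nat_const_nat subn1.
have termE b : (0 < b)%N ->
    INR N * (INR (totient b) / INR b ^ 2) = INR (totient b) * (INR N / INR (b * b)).
  by move=> b_gt0; rewrite INR_mul; field; apply: not_0_INR; lia.
have NF : INR N * totient_sum M = \rsum_(1 <= b < M.+1) (INR (totient b) * (INR N / INR (b * b))).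
  by rewrite rsum_distrr; apply: eq_big_nat => b /andP[b_gt0 _]; exact: termE.
have up1 : \rsum_(1 <= b < M.+1) INR (totient b * (N %/ (b * b) + 1)) <=
    INR N * totient_sum M + \rsum_(1 <= b < M.+1) INR (totient b).
  rewrite NF rsum_add; apply: rsum_le => b /andP[b_gt0 _].
  have bb : (0 < b * b)%N by rewrite muln_gt0 b_gt0.
  have [_ /(Rmult_le_compat_l _ _ _ (pos_INR (totient b)))] := INR_divn_bounds N bb.
  by rewrite (INR_mul (totient b)) INR_add [INR 1]/=; lra.
have lo1 : INR N * totient_sum M <=
    \rsum_(1 <= b < M.+1) INR (totient b * (N %/ (b * b))) + \rsum_(1 <= b < M.+1) INR (totient b).
  rewrite NF rsum_add; apply: rsum_le => b /andP[b_gt0 _].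
  have bb : (0 < b * b)%N by rewrite muln_gt0 b_gt0.
  have [/(Rmult_le_compat_l _ _ _ (pos_INR (totient b))) le_q _] := INR_divn_bounds N bb.
  by rewrite (INR_mul (totient b)); lra.
rewrite [INR 2]/= [INR 1]/= in up lo; have r0 := pos_INR r; split; last lra.
have : (2 * INR r + 1) * (INR M * INR M) <= (2 * INR r + 1) * INR N.
  by apply: Rmult_le_compat_l; lra.
lra.
Qed.

Lemma rho_sum_log_bounds r N K : (0 < r)%N -> (0 < N)%N -> (0 < K)%N ->
  6 / PI ^ 2 * INR N * ln (INR N) - (2 * INR r + 3) * INR N <=
    INR (rho_sum (r * r) N) <=
  INR N * ln (INR N) / zeta2 K + (2 / zeta2 K + 4 + 2 * ln (INR K)) * INR N.
Proof.
move=> r_gt0 N_gt0 K_gt0; pose M := Nat.sqrt N.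
have [/leP MN /ltP NM] := PeanoNat.Nat.sqrt_specif N.
have {}NM : (N < M.+1 * M.+1)%N by [].
have {}MN : (M * M <= N)%N by [].
have M_gt0 : (0 < M)%N by case: (M) NM => //; lia.
have N0 : 0 < INR N by apply: lt_0_INR; lia.
have M0 : 0 < INR M by apply: lt_0_INR; lia.
have z_gt0 : 0 < zeta2 K.
  apply: Rlt_le_trans (zeta2_mono K_gt0).
  by rewrite /zeta2 big_nat1 /=; lra.
have pi1 := PI_RGT_0; have pi0 := pow_lt _ 2 PI_RGT_0.
have [lo up] := rho_sum_totient_sum r_gt0 N_gt0 MN NM.
have lnM : 2 * ln (INR M) <= ln (INR N).
  have -> : 2 * ln (INR M) = ln (INR M * INR M) by rewrite ln_mult //; lra.
  by apply: ln_le; [exact: Rmult_lt_0_compat | rewrite -INR_mul; apply/le_INR/leP].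
have lnM1 : ln (INR N) <= 2 * ln (INR M + 1).
  have -> : 2 * ln (INR M + 1) = ln (INR M.+1 * INR M.+1).
    have M1 : 0 < INR M.+1 by apply: lt_0_INR; lia.
    by rewrite -(S_INR M) ln_mult //; lra.
  by apply: ln_le => //; rewrite -INR_mul; apply/le_INR/leP/ltnW.
have lb := totient_sum_lb M; have ub := totient_sum_ub K_gt0 M_gt0.
split.
  (* Half of 6 / pi^2, because ln (M + 1) >= ln N / 2. *)
  have : 3 / PI ^ 2 * ln (INR N) <= totient_sum M.
    apply: (Rmult_le_reg_l (PI ^ 2 / 6)); first lra.
    have -> : PI ^ 2 / 6 * (3 / PI ^ 2 * ln (INR N)) = ln (INR N) / 2 by field; lra.
    lra.
  move/(Rmult_le_compat_l (2 * INR N)).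
  have -> : 2 * INR N * (3 / PI ^ 2 * ln (INR N)) = 6 / PI ^ 2 * INR N * ln (INR N).
    by field; lra.
  lra.
have : totient_sum M <= (1 + ln (INR N) / 2) / zeta2 K + 1 + ln (INR K).
  suff : (1 + ln (INR M)) / zeta2 K <= (1 + ln (INR N) / 2) / zeta2 K by lra.
  by apply: Rmult_le_compat_r; [exact/Rlt_le/Rinv_0_lt_compat | lra].
move/(Rmult_le_compat_l (2 * INR N)).
have -> : 2 * INR N * ((1 + ln (INR N) / 2) / zeta2 K + 1 + ln (INR K)) =
  INR N * ln (INR N) / zeta2 K + (2 / zeta2 K + 2 + 2 * ln (INR K)) * INR N by field; lra.
lra.
Qed.

Lemma rho_sum_asymptotic r : (0 < r)%N ->
  Un_cv (fun N => INR (rho_sum (r * r) N) / (6 / PI ^ 2 * INR N * ln (INR N))) 1.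
Proof.
move=> r_gt0 eps eps_gt0.
have pi1 := PI_RGT_0; have pi0 := pow_lt _ 2 PI_RGT_0; set c := 6 / PI ^ 2.
have c0 : 0 < c by apply: Rdiv_lt_0_compat; lra.
have c1 : PI ^ 2 / 6 = / c by rewrite /c; field; lra.
(* Chosen so that zeta(2) - delta = 1 / (c (1 + eps / 2)): half of eps goes to replacing zeta(2) by
   [zeta2 K], the other half to the linear error. *)
have delta_gt0 : 0 < / c - / (c * (1 + eps / 2)).
  suff : / (c * (1 + eps / 2)) < / c by lra.
  by apply: Rinv_lt_contravar; nra.
have [K K_gt0] := zeta2_lb delta_gt0; rewrite c1 => zK.
have {}zK : / (c * (1 + eps / 2)) < zeta2 K by lra.
have z_gt0 : 0 < zeta2 K.
  by apply: Rlt_trans zK; apply: Rinv_0_lt_compat; nra.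
have zinv : / zeta2 K < c * (1 + eps / 2).
  rewrite -[X in _ < X]Rinv_inv; apply: Rinv_lt_contravar => //.
  by apply: Rmult_lt_0_compat => //; apply: Rinv_0_lt_compat; nra.
(* A common bound for the linear coefficients of both estimates, positive because of its second
   entry. *)
pose B := Rmax (Rabs (2 / zeta2 K + 4 + 2 * ln (INR K))) (2 * INR r + 3).
(* Beyond this threshold B N < (eps / 2) c N ln N. *)
have [N0 N0E] := INR_unbounded (exp (2 * B / (c * eps))).
exists N0.+1 => N /leP/ltP lt_N.
have N_gt0 : (0 < N)%N by apply: leq_ltn_trans _ (introT ltP lt_N).
have n_gt0 : 0 < INR N by apply: lt_0_INR; lia.
have lnN : 2 * B / (c * eps) < ln (INR N).
  rewrite -[X in X < _]ln_exp; apply: ln_increasing; first exact: exp_pos.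
  by apply: Rlt_trans N0E _; apply: lt_INR; lia.
have B_ge : 3 <= B.
  by apply: Rle_trans (Rmax_r _ _); have := pos_INR r; lra.
have ln0 : 0 < ln (INR N).
  by apply: Rlt_trans lnN; apply: Rdiv_lt_0_compat; nra.
have Bln : B < c * (eps / 2) * ln (INR N).
  move/(Rmult_lt_compat_r (c * (eps / 2))): lnN.
  have -> : 2 * B / (c * eps) * (c * (eps / 2)) = B by field; lra.
  by move=> H; have := H ltac:(nra); lra.
have [lo up] := rho_sum_log_bounds r_gt0 N_gt0 K_gt0.
rewrite -/c in lo; set S := INR (rho_sum _ _) in lo up *.
set L := ln (INR N) in ln0 Bln lo up *; set n := INR N in n_gt0 lo up *.
have nL : 0 < n * L by exact: Rmult_lt_0_compat.
have D_gt0 : 0 < c * n * L by rewrite Rmult_assoc; exact: Rmult_lt_0_compat.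
rewrite /Rdist (_ : S / (c * n * L) - 1 = (S - c * n * L) / (c * n * L)); last by field; lra.
have nB : B * n < eps / 2 * (c * n * L) by nra.
have B1 : 2 / zeta2 K + 4 + 2 * ln (INR K) <= B.
  exact: Rle_trans (Rle_abs _) (Rmax_l _ _).
have B2 : 2 * INR r + 3 <= B by exact: Rmax_r.
have up' : S - c * n * L < eps * (c * n * L).
  have : n * L / zeta2 K < n * L * (c * (1 + eps / 2)) by exact: Rmult_lt_compat_l.
  have := Rmult_le_compat_r n _ _ (Rlt_le _ _ n_gt0) B1; lra.
have lo' : - (eps * (c * n * L)) < S - c * n * L.
  have := Rmult_le_compat_r n _ _ (Rlt_le _ _ n_gt0) B2; nra.
apply: Rabs_def1; apply: (Rmult_lt_reg_r (c * n * L)) => //.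
  have -> : (S - c * n * L) / (c * n * L) * (c * n * L) = S - c * n * L.
    by field; lra.
  lra.
have -> : (S - c * n * L) / (c * n * L) * (c * n * L) = S - c * n * L by field; lra.
lra.
Qed.

End SquareRoots.

(* f(N) ~ g(N) as N -> oo, stated as f(N)/g(N) -> 1. *)
Theorem theorem1 (r : nat) (hr : (1 <= r)%nat) :
  Un_cv (fun N : nat =>
           INR (rho_sum (r * r) N) / (6 / PI ^ 2 * INR N * ln (INR N))) 1.
Proof.
apply SquareRoots.rho_sum_asymptotic; destruct hr; reflexivity.
Qed.
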